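(* Assume that $g$ and $\psi_{\ell-1}$, $\ell\in[L]$, are directionally differentiable everywhere on $\mathbb{R}^{\bar N_L}$ and $\mathbb{R}^{n+\bar N_{\ell-1}}$, $\ell\in[L]$, respectively, and locally Lipschitz continuous. If $\theta\in\mathcal{D}$, then $z:=(\theta,u_1,\dots,u_L)\in\mathcal{D}_0$, where $u_\ell:=\psi_{\ell-1}(\theta,u_1,\dots,u_{\ell-1})$ for all $\ell\in[L]$. Conversely, if $z=(\theta,u)\in\mathcal{D}_0$, then $\theta\in\mathcal{D}$.
   Context: Let $n,L,N_1,\dots,N_L$ be positive integers, $[L]=\{1,\dots,L\}$, $\bar N_0=0$, $\bar N_\ell=\sum_{j=1}^{\ell}N_j$, $\bar N=n+\bar N_L$, $\lambda>0$. Let $g:\mathbb{R}^{\bar N_L}\to[0,\infty)$ and $\psi_{\ell-1}:\mathbb{R}^{n+\bar N_{\ell-1}}\to\mathbb{R}^{N_\ell}$ ($\ell\in[L]$) be continuous. Write $u=(u_1,\dots,u_L)$ with $u_\ell\in\mathbb{R}^{N_\ell}$, $\mathbf{u}_\ell=(u_1,\dots,u_\ell)$, $\mathbf{u}_0$ empty, $z=(\theta,u)\in\mathbb{R}^{\bar N}$ with $\theta\in\mathbb{R}^n$. $\|\cdot\|$ is the Euclidean norm. $\Psi(\theta)=g(u_1,\dots,u_L)$ where $u_1=\psi_0(\theta)$ and $u_\ell=\psi_{\ell-1}(\theta,u_1,\dots,u_{\ell-1})$, $\ell=2,\dots,L$. Problem (P) is $\min_{\theta\in\mathbb{R}^n}\Psi(\theta)+\lambda\|\theta\|^2$.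 $F(z)=g(u)+\lambda\|\theta\|^2$; $\mathcal{F}_0=\{z\mid u_\ell=\psi_{\ell-1}(\theta,\mathbf{u}_{\ell-1}),\ \ell\in[L]\}$; problem (P0) is $\min_{z\in\mathcal{F}_0}F(z)$. Directional derivative: $f'(x;d)=\lim_{\tau\downarrow0}\frac{f(x+\tau d)-f(x)}{\tau}$ (componentwise for vector-valued $f$). Tangent cone: $\mathcal{T}_{\mathcal{F}}(x)=\{d\mid\exists\,x^k\to x,\ x^k\in\mathcal{F},\ \tau_k\downarrow0\text{ with }(x^k-x)/\tau_k\to d\}$. Sets of d-stationary points: $\mathcal{D}=\{\theta\in\mathbb{R}^n\mid[\Psi(\cdot)+\lambda\|\cdot\|^2]'(\theta;d_\theta)\ge0\ \forall d_\theta\in\mathbb{R}^n\}$ for (P); $\mathcal{D}_0=\{z\in\mathcal{F}_0\mid F'(z;d)\ge0\ \forall d\in\mathcal{T}_{\mathcal{F}_0}(z)\}$ for (P0). *)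

(* Defs.v *)
From HB Require Import structures.
From mathcomp Require Import all_boot all_order all_algebra.
From mathcomp Require Import all_classical all_reals all_analysis.

Set Implicit Arguments.
Unset Strict Implicit.
Unset Printing Implicit Defensive.

Import Order.TTheory GRing.Theory Num.Theory.
Import numFieldNormedType.Exports.

Local Open Scope classical_set_scope.
Local Open Scope ring_scope.

(* The library norm on row vectors is the sup norm; its topology is the usual
   one, but the Euclidean norm has to be defined. *)
Definition enorm (R : realType) (m : nat) (x : 'rV[R]_m) : R :=
  Num.sqrt (\sum_i x 0 i ^+ 2).

Section DirectionalDerivative.
Variables (R : realType) (V W : normedModType R).
Implicit Types (f : V -> W) (x d : V).

Definition dir_quotient f x d (tau : R) : W :=
  tau^-1 *: (f (x + tau *: d) - f x).

Definition dir_derivable f x d : Prop :=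
  cvg (dir_quotient f x d tau @[tau --> 0^'+]).

(* Meaningful only when [dir_derivable f x d] holds. *)
Definition dir_deriv f x d : W :=
  lim (dir_quotient f x d tau @[tau --> 0^'+]).

Definition dir_differentiable f : Prop := forall x d, dir_derivable f x d.

(* [tau_k \downarrow 0] is read as: [tau_k > 0] and [tau_k --> 0]. *)
Definition tangent_cone (A : set V) x : set V :=
  [set d | exists (y : V ^nat) (tau : R ^nat),
    [/\ y @ \oo --> x,
        forall k, A (y k),
        forall k, 0 < tau k,
        tau @ \oo --> 0
      & (tau k)^-1 *: (y k - x) @[k --> \oo] --> d]].

End DirectionalDerivative.

(* The norms are explicit so that the Euclidean norm can be used on row
   vectors instead of the library's sup norm. *)
Definition locally_lipschitz (R : realType) (V W : normedModType R)
    (normV : V -> R) (normW : W -> R) (f : V -> W) : Prop :=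
  forall x : V, exists2 U : set V, nbhs x U &
    exists K : R, forall y z, U y -> U z ->
      normW (f y - f z) <= K * normV (y - z).

(* Blocks are numbered from 0: [N l] is the size of u_(l+1), and only the values
   [N l] with [l < L] matter. [Nbar] is a fixpoint
   rather than a sum so that ['rV_(Nbar N l.+1)] and ['rV_(Nbar N l + N l)] are
   convertible. *)
Fixpoint Nbar (N : nat -> nat) (l : nat) : nat :=
  if l is l'.+1 then (Nbar N l' + N l')%N else 0%N.

Lemma NbarE (N : nat -> nat) (l : nat) : Nbar N l = (\sum_(j < l) N j)%N.
Proof. by elim: l => [|l IH] /=; rewrite ?big_ord0 // big_ord_recr IH. Qed.

Lemma leq_Nbar (N : nat -> nat) (l m : nat) :
  (l <= m)%N -> (Nbar N l <= Nbar N m)%N.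
Proof.
elim: m => [|m IH]; first by rewrite leqn0 => /eqP->.
by rewrite leq_eqVlt => /predU1P[->//|/IH le_lm]; apply: leq_trans le_lm (leq_addr _ _).
Qed.

Section Problems.
Variables (R : realType) (n L : nat) (N : nat -> nat).
Variable g : 'rV[R]_(Nbar N L) -> R.
Variable psi : forall l : nat, 'rV[R]_(n + Nbar N l) -> 'rV[R]_(N l).
Variable lambda : R.

Definition uprefix (u : 'rV[R]_(Nbar N L)) (l : 'I_L) : 'rV[R]_(Nbar N l) :=
  colsub (widen_ord (leq_Nbar N (ltnW (ltn_ord l)))) u.

(* Coordinates Nbar l, ..., Nbar l.+1 - 1 of [u]. *)
Definition ublock (u : 'rV[R]_(Nbar N L)) (l : 'I_L) : 'rV[R]_(N l) :=
  colsub (fun j : 'I_(N l) =>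
    widen_ord (leq_Nbar N (ltn_ord l)) (rshift (Nbar N l) j)) u.

(* The first [l] blocks generated from [theta] by the recursion
   u_(l+1) = psi_l (theta, u_1, ..., u_l). *)
Fixpoint ugen (theta : 'rV[R]_n) (l : nat) : 'rV[R]_(Nbar N l) :=
  if l is l'.+1 then
    row_mx (ugen theta l') (psi (row_mx theta (ugen theta l')))
  else 0.

Definition Psi (theta : 'rV[R]_n) : R := g (ugen theta L).

Definition objP (theta : 'rV[R]_n) : R := Psi theta + lambda * enorm theta ^+ 2.

Definition objP0 (z : 'rV[R]_(n + Nbar N L)) : R :=
  g (rsubmx z) + lambda * enorm (lsubmx z) ^+ 2.

Definition feasP0 : set 'rV[R]_(n + Nbar N L) :=
  [set z | forall l : 'I_L,
    ublock (rsubmx z) l = psi (row_mx (lsubmx z) (uprefix (rsubmx z) l))].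

(* In both sets, [f'(x; d) >= 0] includes the existence of [f'(x; d)]. *)
Definition dstatP : set 'rV[R]_n :=
  [set theta | forall d, dir_derivable (objP : _ -> R^o) theta d /\
    0 <= dir_deriv (objP : _ -> R^o) theta d].

Definition dstatP0 : set 'rV[R]_(n + Nbar N L) :=
  [set z | feasP0 z /\ forall d, tangent_cone feasP0 z d ->
    dir_derivable (objP0 : _ -> R^o) z d /\
    0 <= dir_deriv (objP0 : _ -> R^o) z d].

End Problems.

(* Main.v *)
Require Import Defs.
From HB Require Import structures.
From mathcomp Require Import all_boot all_order all_algebra.
From mathcomp Require Import all_classical all_reals all_analysis.
From mathcomp Require Import ring.

Set Implicit Arguments.
Unset Strict Implicit.
Unset Printing Implicit Defensive.

Import Order.TTheory GRing.Theory Num.Theory.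
Import numFieldNormedType.Exports.

Local Open Scope classical_set_scope.
Local Open Scope ring_scope.

(** The equality constraints of (P0) determine u from theta, so its feasible
    set is the graph of the trajectory map G : theta |-> (theta, u(theta))
    ([feasP0_row_mx]), and the objective of (P) is the objective F of (P0)
    composed with G.  Two facts then give both implications at once:
      - the tangent cone of the feasible set at G(theta) consists exactly of the
        directions G'(theta; d)
        ([tangent_cone_feasP0], [hadamard_tangent_cone]);
      - F'(G(theta); G'(theta; d)) = (F o G)'(theta; d)
        ([dir_deriv_feasible_point]).

    Both rest on a chain rule, which fails for plain directional derivatives:
    the increments of the inner function only converge to a direction, without
    staying on a ray.  The derivative must therefore allow the direction to
    vary, that is, be taken in the sense of Hadamard, as the
    limit of (f (x + tau e) - f x) / tau when tau tends to 0 from the right and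
    e tends to d simultaneously.  For a locally Lipschitz function this joint
    limit exists as soon as the directional derivative does
    ([lipschitz_hadamard]), and it is stable under composition
    ([hadamard_derivative_comp]) and pairing ([hadamard_derivative_row_mx]);
    hence, by induction on the number of blocks, G has a Hadamard derivative
    whose first component is d itself. *)

(** * Hadamard directional derivatives *)

Lemma cvg_near_eq T (U : nbhsType) (F : set_system T) {FF : Filter F}
    (f h : T -> U) (l : U) :
  f @ F --> l -> {near F, f =1 h} -> h @ F --> l.
Proof.
move=> fl fh A /fl; rewrite /fmap /= /nbhs /=.
by apply: filterS2 fh => t /= ->.
Qed.

Definition hadamard_derivative (R : realType) (V W : normedModType R)
    (f : V -> W) (x d : V) (w : W) : Prop :=
  dir_quotient f x p.2 p.1 @[p --> filter_prod (0 : R)^'+ (nbhs d)] --> w.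

Section Hadamard.
Context {R : realType}.
Implicit Types V W X : normedModType R.

Lemma scale_quotientK V (x y : V) (tau : R) :
  0 < tau -> x + tau *: (tau^-1 *: (y - x)) = y.
Proof. by move=> tau0; rewrite scalerA divff ?gt_eqF// scale1r addrC subrK. Qed.

Lemma near_fst_gt0 V (d : V) :
  \forall p \near filter_prod (0 : R)^'+ (nbhs d), 0 < p.1.
Proof.
exact: (@cvg_fst _ _ 0^'+ (nbhs d) _ [set t | 0 < t] (nbhs_right_gt 0)).
Qed.

Lemma cvg_fst_at_right0 V (d : V) :
  p.1 @[p --> filter_prod (0 : R)^'+ (nbhs d)] --> (0 : R).
Proof.
move=> A A0.
suff A0r : (0 : R)^'+ A by exact: (@cvg_fst _ _ 0^'+ (nbhs d) _ A A0r).
exact: (cvg_within (fun u => 0 < u) A0).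
Qed.

(** The index filter is arbitrary because three kinds of families of steps and
    directions are substituted below: a constant direction, a sequence, and the
    difference quotients of another function. *)
Lemma hadamard_derivative_along V W (f : V -> W) x d w T (F : set_system T)
    {FF : Filter F} (tau : T -> R) (e : T -> V) :
  hadamard_derivative f x d w -> tau @ F --> (0 : R)^'+ -> e @ F --> d ->
  dir_quotient f x (e t) (tau t) @[t --> F] --> w.
Proof.
move=> fw tau0 ed.
exact: (cvg_comp (fun t => (tau t, e t)) _ (cvg_pair tau0 ed) fw).
Qed.

Lemma hadamard_dir_derivative V W (f : V -> W) x d w :
  hadamard_derivative f x d w ->
  dir_derivable f x d /\ dir_deriv f x d = w.
Proof.
move=> fw.
have cvgw : dir_quotient f x d tau @[tau --> 0^'+] --> w.
  by apply: (hadamard_derivative_along fw); [exact: cvg_id|exact: cvg_cst].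
by split; [apply/cvg_ex; exists w | exact: cvg_lim cvgw].
Qed.

Lemma hadamard_derivative_seq V W (f : V -> W) x d w
    (y : V ^nat) (tau : R ^nat) :
  hadamard_derivative f x d w ->
  (forall k, 0 < tau k) -> tau @ \oo --> (0 : R) ->
  (tau k)^-1 *: (y k - x) @[k --> \oo] --> d ->
  (tau k)^-1 *: (f (y k) - f x) @[k --> \oo] --> w.
Proof.
move=> fw tau_gt0 tau0 yd.
have tau0r : tau @ \oo --> (0 : R)^'+.
  by move=> A /tau0; apply: (@filterS _ \oo) => k /(_ (tau_gt0 k)).
apply: (cvg_near_eq (hadamard_derivative_along fw tau0r yd)).
apply: nearW => k /=.
by rewrite /dir_quotient scale_quotientK.
Qed.

(** With e' := (f (x + tau e) - f x) / tau, the point f (x + tau e) is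
    f x + tau e', so a quotient of [h \o f] is a quotient of [h] whose direction
    e' tends to w. *)
Lemma hadamard_derivative_comp V W X (f : V -> W) (h : W -> X) x d w v :
  hadamard_derivative f x d w -> hadamard_derivative h (f x) w v ->
  hadamard_derivative (h \o f) x d v.
Proof.
move=> fw hv.
apply: (cvg_near_eq (hadamard_derivative_along hv cvg_fst fw)).
near=> p.
rewrite /dir_quotient /= scale_quotientK//.
by near: p; exact: near_fst_gt0.
Unshelve. all: by end_near. Qed.

Lemma hadamard_derivative_linear V W (f : {linear V -> W}) x d :
  continuous f -> hadamard_derivative f x d (f d).
Proof.
move=> fc.
have fd : f p.2 @[p --> filter_prod (0 : R)^'+ (nbhs d)] --> f d.
  exact: (cvg_comp snd f cvg_snd (fc d)).
apply: (cvg_near_eq fd); near=> p.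
rewrite /dir_quotient /= -(linearB f) addrAC subrr add0r.
rewrite linearZ_LR scalerA mulVf ?scale1r//.
by rewrite gt_eqF//; near: p; exact: near_fst_gt0.
Unshelve. all: by end_near. Qed.

Lemma hadamard_derivative_id V (x d : V) : hadamard_derivative id x d d.
Proof. exact: (@hadamard_derivative_linear _ _ idfun x d (fun=> cvg_id)). Qed.

Lemma hadamard_derivativeD V W (f h : V -> W) x d w v :
  hadamard_derivative f x d w -> hadamard_derivative h x d v ->
  hadamard_derivative (fun y => f y + h y) x d (w + v).
Proof.
move=> fw hv; apply: (cvg_near_eq (cvgD fw hv)).
apply: nearW => p; rewrite /dir_quotient -[LHS]scalerDr; congr (_ *: _).
by rewrite opprD addrACA.
Qed.

(** Replacing the direction d by e changes the quotient by at most
    K |tau (e - d)| / tau = K |e - d|, which tends to 0. *)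
Lemma lipschitz_hadamard V W (f : V -> W) x d :
  locally_lipschitz Num.norm Num.norm f -> dir_derivable f x d ->
  hadamard_derivative f x d (dir_deriv f x d).
Proof.
move=> /(_ x)[U Ux [K KP]] fd.
pose F := filter_prod (0 : R)^'+ (nbhs d).
have tau0 : p.1 @[p --> F] --> (0 : R) by exact: cvg_fst_at_right0.
have e_d : p.2 @[p --> F] --> d by exact: cvg_snd.
have fd' : dir_quotient f x d p.1 @[p --> F] --> dir_deriv f x d.
  exact: (cvg_comp fst _ (cvg_fst (F := (0:R)^'+)) fd).
have Ue : \forall p \near F, U (x + p.1 *: p.2).
  have : x + p.1 *: p.2 @[p --> F] --> x.
    rewrite -[X in _ --> X]addr0 -[X in _ + X](scale0r d).
    by apply: cvgD; [exact: cvg_cst|exact: cvgZ].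
  by apply.
have Ud : \forall p \near F, U (x + p.1 *: d).
  have : x + p.1 *: d @[p --> F] --> x.
    rewrite -[X in _ --> X]addr0 -[X in _ + X](scale0r d).
    by apply: cvgD; [exact: cvg_cst|apply: cvgZ => //; exact: cvg_cst].
  by apply.
have diff0 : dir_quotient f x p.2 p.1 - dir_quotient f x d p.1 @[p --> F]
    --> (0 : W).
  apply: norm_cvg0.
  apply: (squeeze_cvgr (f := fun=> 0) (h := fun p => K * `|p.2 - d|)).
  - near=> p; rewrite normr_ge0/= /dir_quotient -scalerBr.
    have p0 : 0 < p.1 by near: p; exact: near_fst_gt0.
    rewrite opprB addrA subrK normrZ gtr0_norm ?invr_gt0//.
    rewrite ler_pdivrMl//.
    apply: (le_trans (KP _ _ _ _)); [by near: p|by near: p|].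
    rewrite opprD addrACA subrr add0r -scalerBr normrZ gtr0_norm//.
    by rewrite mulrCA.
  - exact: cvg_cst.
  - rewrite -(mulr0 K); apply: cvgM; first exact: cvg_cst.
    rewrite -(normr0 V) -(subrr d); apply: cvg_norm.
    by apply: cvgB => //; exact: cvg_cst.
rewrite -[dir_deriv f x d]add0r; apply: (cvg_near_eq (cvgD diff0 fd')).
by apply: nearW => p /=; rewrite subrK.
Unshelve. all: by end_near. Qed.

(** Passes from the Euclidean norms of the Lipschitz hypotheses to the norms
    that define the topology. *)
Lemma locally_lipschitz_le_norm V W (normV : V -> R) (normW : W -> R) (C : R)
    (f : V -> W) :
  (forall v, 0 <= normV v <= C * `|v|) -> (forall w, `|w| <= normW w) ->
  locally_lipschitz normV normW f -> locally_lipschitz Num.norm Num.norm f.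
Proof.
move=> nV nW flip x; have [U Ux [K KP]] := flip x.
(* The absolute value is there because K may be negative. *)
exists U => //; exists (`|K| * C) => y z Uy Uz.
apply: (le_trans (nW _)); apply: (le_trans (KP _ _ Uy Uz)).
have /andP[n0 nC] := nV (y - z).
apply: (@le_trans _ _ (`|K| * normV (y - z))).
  by rewrite ler_wpM2r// ler_norm.
by rewrite -mulrA ler_wpM2l.
Qed.

End Hadamard.

(** * Row vectors *)

Section RowVectors.
Context {R : realType}.

Lemma le_coord_norm m (x : 'rV[R]_m) i : `|x 0 i| <= `|x|.
Proof.
rewrite [leRHS]/Num.norm /= mx_normrE.
exact: (le_bigmax _ (fun ij : 'I_1 * 'I_m => `|x ij.1 ij.2|) (0, i)).
Qed.

Lemma enorm_sqr m (x : 'rV[R]_m) : enorm x ^+ 2 = \sum_i x 0 i ^+ 2.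
Proof. by rewrite sqr_sqrtr// sumr_ge0// => i _; rewrite sqr_ge0. Qed.

Lemma norm_le_enorm m (x : 'rV[R]_m) : `|x| <= enorm x.
Proof.
rewrite [leLHS]/Num.norm /= mx_normrE; apply/bigmax_leP; split.
  exact: sqrtr_ge0.
move=> [i j] _ /=; rewrite (ord1 i) -sqrtr_sqr ler_wsqrtr//.
by rewrite (bigD1 j)//= lerDl sumr_ge0// => k _; rewrite sqr_ge0.
Qed.

Lemma enorm_le_norm m (x : 'rV[R]_m) : enorm x <= Num.sqrt m%:R * `|x|.
Proof.
rewrite -[`|x|]ger0_norm// -sqrtr_sqr -sqrtrM// ler_wsqrtr//.
apply: (@le_trans _ _ (\sum_(i < m) `|x| ^+ 2)).
  apply: ler_sum => i _; rewrite -[x 0 i ^+ 2]real_normK ?num_real//.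
  by rewrite lerXn2r ?nnegrE// le_coord_norm.
by rewrite sumr_const card_ord mulr_natl.
Qed.

Lemma locally_lipschitz_enorm m (W : normedModType R) (normW : W -> R)
    (f : 'rV[R]_m -> W) :
  (forall w, `|w| <= normW w) ->
  locally_lipschitz (@enorm R m) normW f ->
  locally_lipschitz Num.norm Num.norm f.
Proof.
move=> nW; apply: (@locally_lipschitz_le_norm _ _ _ _ _ (Num.sqrt m%:R)) => //.
by move=> v; rewrite sqrtr_ge0 enorm_le_norm.
Qed.

Lemma cvg_row_mx m1 m2 T (F : set_system T) {FF : Filter F}
    (a : T -> 'rV[R]_m1) (b : T -> 'rV[R]_m2)
    (a0 : 'rV[R]_m1) (b0 : 'rV[R]_m2) :
  a @ F --> a0 -> b @ F --> b0 ->
  row_mx (a t) (b t) @[t --> F] --> row_mx a0 b0.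
Proof.
move=> /cvgrPdist_lt aa0 /cvgrPdist_lt bb0.
apply/cvgrPdist_lt => e e0.
near=> t.
rewrite opp_row_mx add_row_mx [ltLHS]/Num.norm /= mx_normrE.
apply/bigmax_ltP; split => // -[i j] _ /=; rewrite (ord1 i).
case: (splitP j) => k jk.
  have -> : j = lshift m2 k by apply: val_inj.
  rewrite row_mxEl; apply: (le_lt_trans (le_coord_norm _ _)).
  by near: t; exact: aa0.
have -> : j = rshift m1 k by apply: val_inj.
rewrite row_mxEr; apply: (le_lt_trans (le_coord_norm _ _)).
by near: t; exact: bb0.
Unshelve. all: by end_near. Qed.

Lemma hadamard_derivative_row_mx (V : normedModType R) m1 m2
    (f : V -> 'rV[R]_m1) (h : V -> 'rV[R]_m2) x d w v :
  hadamard_derivative f x d w -> hadamard_derivative h x d v ->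
  hadamard_derivative (fun y => row_mx (f y) (h y)) x d (row_mx w v).
Proof.
move=> fw hv; apply: (cvg_near_eq (cvg_row_mx fw hv)); apply: nearW => p /=.
by rewrite /dir_quotient opp_row_mx add_row_mx scale_row_mx.
Qed.

Lemma hadamard_derivative_sqr_enorm m (c : R) (x d : 'rV[R]_m) :
  hadamard_derivative (fun y => c * enorm y ^+ 2 : R^o) x d
    (c * \sum_i 2 * x 0 i * d 0 i).
Proof.
pose F := filter_prod (0 : R)^'+ (nbhs d).
have tau0 : p.1 @[p --> F] --> (0 : R) by exact: cvg_fst_at_right0.
have e_d i : (p : R * 'rV[R]_m).2 0 i @[p --> F] --> d 0 i.
  apply: (cvg_comp snd (fun e : 'rV[R]_m => e 0 i) cvg_snd).
  exact: coord_continuous.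
have lim : c * \sum_i (2 * x 0 i * (p : R * 'rV[R]_m).2 0 i
      + p.1 * p.2 0 i ^+ 2) @[p --> F] --> c * \sum_i 2 * x 0 i * d 0 i.
  apply: cvgM; first exact: cvg_cst.
  apply: cvg_big => [|i _]; first exact: add_continuous.
  rewrite -[X in _ --> X]addr0 -[X in _ + X](mul0r (d 0 i ^+ 2)).
  apply: cvgD; apply: cvgM => //; first exact: cvg_cst.
  by rewrite expr2; apply: cvgM.
(* ((x + tau e)^2 - x^2) / tau = 2 x e + tau e^2, coordinate by coordinate. *)
apply: (cvg_near_eq lim); near=> p.
have p0 : 0 < p.1 by near: p; exact: near_fst_gt0.
rewrite /dir_quotient !enorm_sqr -mulrBr -sumrB /GRing.scale /= mulrCA.
congr (_ * _); rewrite mulr_sumr; apply: eq_bigr => i _; rewrite !mxE.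
by field; rewrite gt_eqF.
Unshelve. all: by end_near. Qed.

End RowVectors.

(** * The feasible set as a graph *)

Section Feasibility.
Context {R : realType} {n L : nat} {N : nat -> nat}.
Variable psi : forall l : nat, 'rV[R]_(n + Nbar N l) -> 'rV[R]_(N l).

(** The recursion only appends blocks, so the first [l] blocks do not depend on
    how far it is run.  [le_Nbar] is arbitrary since different proofs of this
    inequality occur inside the column selections. *)
Lemma colsub_ugen (theta : 'rV[R]_n) (l m : nat)
    (le_lm : (l <= m)%N) (le_Nbar : (Nbar N l <= Nbar N m)%N) :
  colsub (widen_ord le_Nbar) (ugen psi theta m) = ugen psi theta l.
Proof.
elim: m le_lm le_Nbar => [|m IHm].
  by rewrite leqn0 => /eqP -> le00; apply/rowP => -[].
rewrite leq_eqVlt => /predU1P[-> le_Nbar|le_lm le_Nbar].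
  by apply/rowP => j; rewrite mxE; congr (_ _ _); exact: val_inj.
have le_Nbar' := leq_Nbar N (le_lm : (l <= m)%N).
rewrite -(IHm le_lm le_Nbar'); apply/rowP => j; rewrite mxE [RHS]mxE /=.
have -> : widen_ord le_Nbar j = lshift (N m) (widen_ord le_Nbar' j).
  exact: val_inj.
by rewrite row_mxEl.
Qed.

(** The constraints say that each block of u is the one produced by the
    recursion from the preceding blocks, so by induction all prefixes of u agree
    with those of [ugen]. *)
Lemma feasP0_row_mx (theta : 'rV[R]_n) (u : 'rV[R]_(Nbar N L)) :
  feasP0 psi (row_mx theta u) <-> u = ugen psi theta L.
Proof.
rewrite /feasP0 /= row_mxKl row_mxKr; split => [feas|-> l].
  suff prefix l (le_lL : (l <= L)%N) :
      colsub (widen_ord (leq_Nbar N le_lL)) u = ugen psi theta l.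
    rewrite -(prefix L (leqnn L)); apply/rowP => j; rewrite mxE.
    by congr (u _ _); exact: val_inj.
  elim: l le_lL => [|l IHl] lt_lL; first by apply/rowP => -[].
  have prefix_l : uprefix u (Ordinal lt_lL) = ugen psi theta l.
    rewrite -(IHl (ltnW lt_lL)); apply/rowP => j.
    by rewrite !mxE; congr (u _ _); exact: val_inj.
  apply/rowP => j /=; case: (splitP j) => k jk.
    have -> : j = lshift (N l) k by exact: val_inj.
    rewrite row_mxEl -prefix_l !mxE; congr (u _ _); exact: val_inj.
  have -> : j = rshift (Nbar N l) k by exact: val_inj.
  rewrite row_mxEr -prefix_l -(feas (Ordinal lt_lL)) !mxE.
  by congr (u _ _); exact: val_inj.
rewrite /uprefix colsub_ugen ?(ltnW (ltn_ord l))//.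
apply/rowP => j; rewrite mxE.
have := colsub_ugen theta (ltn_ord l) (leq_Nbar N (ltn_ord l)).
move=> /rowP /(_ (rshift (Nbar N l) j)); rewrite mxE => ->.
by rewrite /= row_mxEr.
Qed.

Lemma feasP0P (z : 'rV[R]_(n + Nbar N L)) :
  feasP0 psi z <-> z = row_mx (lsubmx z) (ugen psi (lsubmx z) L).
Proof.
rewrite -{1}[z]hsubmxK feasP0_row_mx; split => [<-|{1}->].
  by rewrite hsubmxK.
by rewrite row_mxKr.
Qed.

Definition feasible_point (theta : 'rV[R]_n) : 'rV[R]_(n + Nbar N L) :=
  row_mx theta (ugen psi theta L).

(** The new block is [psi m] composed with theta |-> (theta, first m blocks), so
    the chain rule and pairing carry the induction. *)
Lemma hadamard_derivative_ugen (m : nat) (theta d : 'rV[R]_n) :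
  (forall l, (l < m)%N -> forall x e, exists w,
    hadamard_derivative (@psi l) x e w) ->
  exists w, hadamard_derivative (ugen psi ^~ m) theta d w.
Proof.
elim: m => [|m IHm] psi_had.
  exists 0; apply: (cvg_near_eq (cvg_cst 0)); apply: nearW => p.
  by rewrite /dir_quotient subrr scaler0.
have [w uw] := IHm (fun l lt_lm => psi_had l (ltnW lt_lm)).
have pw := hadamard_derivative_row_mx (@hadamard_derivative_id _ _ theta d) uw.
have [v pv] :=
  psi_had m (leqnn _) (row_mx theta (ugen psi theta m)) (row_mx d w).
exists (row_mx w v).
exact: (hadamard_derivative_row_mx uw (hadamard_derivative_comp pw pv)).
Qed.

End Feasibility.

(** * Tangent directions and stationarity *)

Section Stationarity.
Context {R : realType} {n L : nat} {N : nat -> nat}.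
Variable g : 'rV[R]_(Nbar N L) -> R.
Variable psi : forall l : nat, 'rV[R]_(n + Nbar N l) -> 'rV[R]_(N l).
Variable lambda : R.
Hypothesis g_hadamard : forall x e, exists w,
  hadamard_derivative (g : _ -> R^o) x e w.
Hypothesis psi_hadamard : forall l, (l < L)%N -> forall x e, exists w,
  hadamard_derivative (@psi l) x e w.

Let G : 'rV[R]_n -> 'rV[R]_(n + Nbar N L) := feasible_point psi.

Lemma objP0_feasible_point theta :
  objP0 g lambda (G theta) = objP g psi lambda theta.
Proof. by rewrite /objP0 row_mxKl row_mxKr. Qed.

Lemma hadamard_derivative_feasible_point theta d :
  exists w, hadamard_derivative G theta d (row_mx d w).
Proof.
have [w uw] := hadamard_derivative_ugen theta d psi_hadamard.
exists w.
exact: (hadamard_derivative_row_mx (@hadamard_derivative_id _ _ theta d) uw).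
Qed.

Lemma hadamard_derivative_objP0 (z d : 'rV[R]_(n + Nbar N L)) :
  exists v, hadamard_derivative (objP0 g lambda : _ -> R^o) z d v.
Proof.
have [w gw] := g_hadamard (rsubmx z) (rsubmx d).
exists (w + lambda * \sum_i 2 * (lsubmx z) 0 i * (lsubmx d) 0 i).
apply: hadamard_derivativeD.
  apply: hadamard_derivative_comp gw.
  by apply: hadamard_derivative_linear; exact: continuous_rsubmx.
have sqr_d := @hadamard_derivative_sqr_enorm _ _ lambda (lsubmx z) (lsubmx d).
apply: hadamard_derivative_comp sqr_d.
by apply: hadamard_derivative_linear; exact: continuous_lsubmx.
Qed.

Lemma dir_deriv_feasible_point theta d w :
  hadamard_derivative G theta d w ->
  [/\ dir_derivable (objP g psi lambda : _ -> R^o) theta d,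
      dir_derivable (objP0 g lambda : _ -> R^o) (G theta) w &
      dir_deriv (objP0 g lambda : _ -> R^o) (G theta) w =
      dir_deriv (objP g psi lambda : _ -> R^o) theta d].
Proof.
move=> Gw; have [v objv] := hadamard_derivative_objP0 (G theta) w.
have [dP0 ->] := hadamard_dir_derivative objv.
have := hadamard_derivative_comp Gw objv.
have -> : objP0 g lambda \o G = objP g psi lambda.
  by apply/funext => t /=; rewrite objP0_feasible_point.
by move=> /hadamard_dir_derivative[dP ->].
Qed.

(** A feasible sequence is G(theta_k), where theta_k is its first component and
    (theta_k - theta) / tau_k tends to the first component of d.  The quotients
    of G along theta_k thus tend both to d and to the derivative of G. *)
Lemma tangent_cone_feasP0 theta d :
  tangent_cone (feasP0 psi) (G theta) d ->
  hadamard_derivative G theta (lsubmx d) d.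
Proof.
move=> [y [tau [_ yfeas tau_gt0 tau0 yd]]].
have [w Gw] := hadamard_derivative_feasible_point theta (lsubmx d).
suff -> : d = row_mx (lsubmx d) w by rewrite row_mxKl.
have thd : (tau k)^-1 *: (lsubmx (y k) - theta) @[k --> \oo] --> lsubmx d.
  have := cvg_comp _ lsubmx yd (continuous_lsubmx (x := d)).
  move=> /cvg_near_eq; apply; apply: nearW => k /=.
  by rewrite linearZ /= linearB /= row_mxKl.
have := hadamard_derivative_seq Gw tau_gt0 tau0 thd.
have -> : (fun k => (tau k)^-1 *: (G (lsubmx (y k)) - G theta)) =
          (fun k => (tau k)^-1 *: (y k - G theta)).
  by apply/funext => k; rewrite /G /feasible_point -((feasP0P _ _).1 (yfeas k)).
exact: cvg_unique yd.
Qed.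

(** Witnessed by the feasible points G(theta + tau_k d) with tau_k = 1/(k+1). *)
Lemma hadamard_tangent_cone theta d w :
  hadamard_derivative G theta d w -> tangent_cone (feasP0 psi) (G theta) w.
Proof.
move=> Gw; pose tau k : R := harmonic k.
have tau_gt0 k : 0 < tau k by rewrite /tau /harmonic/= invr_gt0.
have tau0 : tau @ \oo --> (0 : R) by exact: cvg_harmonic.
pose th k := theta + tau k *: d.
have thd : (tau k)^-1 *: (th k - theta) @[k --> \oo] --> d.
  apply: cvg_near_eq (cvg_cst d) _; apply: nearW => k.
  by rewrite /th addrAC subrr add0r scalerA mulVf ?scale1r// gt_eqF.
have Gthw := hadamard_derivative_seq Gw tau_gt0 tau0 thd.
exists (G \o th), tau; split => //=.
- (* G (th k) = G theta + tau k *: q k, where the quotients q k converge. *)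
  have : G theta + tau k *: ((tau k)^-1 *: (G (th k) - G theta)) @[k --> \oo]
      --> G theta + 0 *: w.
    by apply: cvgD; [exact: cvg_cst|exact: cvgZ].
  rewrite scale0r addr0 => /cvg_near_eq; apply; apply: nearW => k /=.
  by rewrite scale_quotientK.
- by move=> k; apply/feasP0_row_mx.
Qed.

End Stationarity.

Theorem lemma3p2 (R : realType) (n L : nat) (N : nat -> nat)
    (g : 'rV[R]_(Nbar N L) -> R)
    (psi : forall l : nat, 'rV[R]_(n + Nbar N l) -> 'rV[R]_(N l))
    (lambda : R)
    (n_gt0 : (0 < n)%N) (L_gt0 : (0 < L)%N)
    (N_gt0 : forall l, (l < L)%N -> (0 < N l)%N)
    (lambda_gt0 : 0 < lambda)
    (g_ge0 : forall u, 0 <= g u)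
    (g_cont : continuous g)
    (psi_cont : forall l, (l < L)%N -> continuous (psi l))
    (g_dd : dir_differentiable (g : _ -> R^o))
    (psi_dd : forall l, (l < L)%N -> dir_differentiable (psi l))
    (g_lip : locally_lipschitz (@enorm R (Nbar N L)) (fun y : R^o => `|y|) g)
    (psi_lip : forall l, (l < L)%N ->
      locally_lipschitz (@enorm R (n + Nbar N l)) (@enorm R (N l)) (psi l)) :
  (forall theta : 'rV[R]_n,
     dstatP g psi lambda theta ->
     dstatP0 g psi lambda (row_mx theta (ugen psi theta L))) /\
  (forall (theta : 'rV[R]_n) (u : 'rV[R]_(Nbar N L)),
     dstatP0 g psi lambda (row_mx theta u) ->
     dstatP g psi lambda theta).
Proof.
have g_hadamard x e : exists w, hadamard_derivative (g : _ -> R^o) x e w.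
  exists (dir_deriv (g : _ -> R^o) x e); apply: lipschitz_hadamard => //.
  exact: locally_lipschitz_enorm g_lip.
have psi_hadamard l : (l < L)%N ->
    forall x e, exists w, hadamard_derivative (psi l) x e w.
  move=> lL x e; exists (dir_deriv (psi l) x e).
  apply: lipschitz_hadamard; last exact: psi_dd.
  by apply: locally_lipschitz_enorm (psi_lip l lL) => w; exact: norm_le_enorm.
split=> [theta Dtheta|theta u [/feasP0_row_mx -> D0] d].
  split=> [|d /(tangent_cone_feasP0 psi_hadamard) ld].
    exact/feasP0_row_mx.
  have [_ d0 ->] := dir_deriv_feasible_point lambda g_hadamard ld.
  by split => //; have [] := Dtheta (lsubmx d).
have [w lw] := hadamard_derivative_feasible_point psi_hadamard theta d.
have [dP d0 <-] := dir_deriv_feasible_point lambda g_hadamard lw.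
by split => //; have [] := D0 _ (hadamard_tangent_cone lw).
Qed.
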